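(* In the family of examples described in the context, there exists a sequence $(c_i)_{i\ge0}$ (with $c_i=\cos\theta_i$) so that $(x_h^j)_{j\ge0}$ and $(x_f^j)_{j\ge0}$ converge strongly, but not linearly. In particular, for any $\alpha>1/2$, there is an initial point $z^0\in\mathcal H$ so that for all $k\ge1$, $$\|x_h^k-x^*\|^2\ge\frac1{(k+1)^{2\alpha}}\qquad\text{and}\qquad\|x_f^k-x^*\|^2\ge\frac{(a+1/2)^2}{(a+1)^2(k+1)^{2\alpha}}.$$ Thus, the nonergodic ''best'' convergence rates of FDRS under strong convexity (the best-iterate rates (B) recalled in the context) are sharp.
   Context: General FDRS (forward-Douglas-Rachford splitting) setting. $\mathcal H$ is a real Hilbert space with identity $I$, $V\subseteq\mathcal H$ is a closed vector subspace with orthogonal projection $P_V$, $\chi_C$ denotes the indicator function of a set $C$ ($0$ on $C$, $+\infty$ elsewhere), $f,g:\mathcal H\to(-\infty,\infty]$ are closed, proper and convex, $g$ is differentiable with Lipschitz gradient, $h:=g\circ P_V$, $\nabla h=P_V\circ\nabla g\circ P_V$ is $(1/\beta_V)$-Lipschitz, and there is $x$ with $0\in\partial f(x)+\nabla g(x)+\partial\chi_V(x)$. With $\mathrm{prox}_{\gamma f}(x):=\arg\min_y\left(f(y)+\frac1{2\gamma}\|y-x\|^2\right)$, $\mathrm{refl}_{\gamma f}:=2\,\mathrm{prox}_{\gamma f}-I$, $\mathrm{refl}_{\chi_V}:=2P_V-I$, the FDRS operator is $T:=\left(\frac12I+\frac12\mathrm{refl}_{\gamma f}\circ\mathrm{refl}_{\chi_V}\right)\circ(I-\gamma\nabla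 h)$; the FDRS iteration from $z^0\in\mathcal H$ is $z^{k+1}=(1-\lambda_k)z^k+\lambda_kTz^k$. For each $k$: $x_h^k:=P_Vz^k$ and $x_f^k:=\mathrm{prox}_{\gamma f}\big(\mathrm{refl}_{\chi_V}(z^k-\gamma\nabla h(z^k))\big)$. Also $z^*$ is a fixed point of $T$ and $x^*:=P_Vz^*$. Best-iterate rates (B). Let $f$ and $g$ be $\mu_f$- and $\mu_g$-strongly convex ($\mu_f,\mu_g\ge0$, zero meaning no strong convexity), and let $f$ have $(1/\beta_f)$-Lipschitz gradient if $\beta_f>0$ (with $\beta_f=0$ meaning no such assumption). Put $S_f(x,y):=\max\{\frac{\mu_f}2\|x-y\|^2,\frac{\beta_f}2\|\nabla f(x)-\nabla f(y)\|^2\}$ if $\beta_f>0$ and $S_f(x,y):=\frac{\mu_f}2\|x-y\|^2$ otherwise, and $S_h(x,y):=\max\{\frac{\mu_g}2\|P_Vx-P_Vy\|^2,\frac{\beta_V}2\|\nabla h(x)-\nabla h(y)\|^2\}$. If $\gamma\in(0,2\beta_V)$, $\alpha_0:=\frac{2\beta_V}{4\beta_V-\gamma}$, $\varepsilon\in(0,1)$, $(\lambda_j)_{j\ge0}\subseteq\left(0,\frac{(1-\varepsilon)(1+\varepsilon\alpha_0)}{\alpha_0}\right)$ and $\underline\lambda:=\inf_j\lambda_j>0$, then $$\min_{0\le j\le k}\left(S_f(x_f^j,x^* )+S_h(x_h^j,x^* )\right)\le\frac{\left(1+\frac{(1+\varepsilon)\gamma}{\varepsilon^3(2\beta_V-\gamma)}\right)\|z^0-z^*\|^2}{4\gamma\underline\lambda(k+1)},$$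 and $\min_{0\le j\le k}S_f(x_f^j,x^* )=o(1/(k+1))$ and $\min_{0\le j\le k}S_h(x_h^j,x^* )=o(1/(k+1))$. The family of examples. Let $\mathcal H:=\ell_2^2(\mathbb N)=\mathbb R^2\oplus\mathbb R^2\oplus\cdots$ (square-summable sequences of vectors in $\mathbb R^2$). Let $e_0:=(1,0)$ and let $e_\theta$ be the counterclockwise rotation of $e_0$ by angle $\theta$. For a sequence of angles $(\theta_j)_{j\ge0}\subseteq(0,\pi/2]$ with $\theta_i\to0$, let $c_i:=\cos(\theta_i)$, $V:=\mathbb Re_0\oplus\mathbb Re_0\oplus\cdots$ and $U:=\mathbb Re_{\theta_0}\oplus\mathbb Re_{\theta_1}\oplus\cdots$. Fix $a\ge0$ and set $f:=\chi_U+\frac a2\|\cdot\|^2$, $g:=\frac12\|\cdot\|^2$, $h:=g\circ P_V$ (so $\nabla h=P_V$, $\mu_g=1$, $\mu_f=a$, $\beta_V=1$), $\gamma:=1$ and $\lambda_k\equiv1$, so that $z^{k+1}=Tz^k$. The only fixed point of $T$ is $z^*=0$, and $x^*=P_Vz^*=0$. *)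

(* Defs.v *)
From HB Require Import structures.
From mathcomp Require Import all_boot all_order all_algebra.
From mathcomp Require Import all_classical all_reals all_analysis.
From mathcomp Require Import ring lra.
Set Implicit Arguments.
Unset Strict Implicit.
Unset Printing Implicit Defensive.
Import Order.TTheory GRing.Theory Num.Theory.
Import numFieldNormedType.Exports.
Local Open Scope classical_set_scope.
Local Open Scope ring_scope.

(* Real Hilbert spaces: complete normed spaces whose norm comes from a
   symmetric bilinear form. *)
HB.mixin Record CompleteNormedModule_isHilbert (R : realType) H
    & CompleteNormedModule R H := {
  inner : H -> H -> R ;
  innerC : forall x y, inner x y = inner y x ;
  innerDl : forall x y z, inner (x + y) z = inner x z + inner y z ;
  innerZl : forall a x y, inner (a *: x) y = a * inner x y ;
  innerxx : forall x, inner x x = `|x| ^+ 2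
}.

#[short(type="hilbertType")]
HB.structure Definition Hilbert (R : realType) :=
  {H of CompleteNormedModule R H & CompleteNormedModule_isHilbert R H}.

Section L2.
Variable R : realType.
Implicit Types u v : R * R.

Definition dot2 u v : R := u.1 * v.1 + u.2 * v.2.

Definition sqsummable : {pred nat -> R * R} :=
  fun s => `[< cvgn (series (fun i => dot2 (s i) (s i))) >].

Lemma dot2_ge0 u : 0 <= dot2 u u.
Proof. by rewrite /dot2 addr_ge0// -expr2 sqr_ge0. Qed.

Lemma sqsummable_lin (a : R) (s t : nat -> R * R) :
  s \in sqsummable -> t \in sqsummable -> a *: s + t \in sqsummable.
Proof.
move=> /asboolP ss /asboolP st; apply/asboolP.
pose v := (2 * a ^+ 2) *: (fun i => dot2 (s i) (s i)) +
          (2 : R) *: (fun i => dot2 (t i) (t i)).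
apply: (@series_le_cvg _ _ v).
- by move=> i; exact: dot2_ge0.
- move=> i; rewrite /v; apply: addr_ge0; apply: mulr_ge0; rewrite ?dot2_ge0//.
  by rewrite mulr_ge0// sqr_ge0.
- move=> i; rewrite /v/= /dot2/= !fctE /GRing.scale/=.
  have h1 := sqr_ge0 (a * (s i).1 - (t i).1).
  have h2 := sqr_ge0 (a * (s i).2 - (t i).2).
  nra.
- by apply: is_cvg_seriesD; apply: is_cvg_seriesZ.
Qed.

Fact sqsummable_submod_closed : submod_closed sqsummable.
Proof.
split; last by move=> a s t; exact: sqsummable_lin.
apply/asboolP; rewrite (_ : series _ = cst 0); first exact: is_cvg_cst.
apply/funext => n; rewrite seriesEnat/= big1// => i _.
by rewrite /dot2/= mul0r addr0.
Qed.

HB.instance Definition _ :=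
  GRing.isSubmodClosed.Build R (nat -> R * R) sqsummable sqsummable_submod_closed.

(* The Hilbert direct sum of countably many copies of the Euclidean plane.  The
   Euclidean structure of R^2 enters only through dot2: the library norm of the
   product type R * R is the max norm and is not used. *)
Record l2 := L2 { l2seq :> nat -> R * R ; l2P : l2seq \in sqsummable }.

HB.instance Definition _ := [isSub for l2seq].
HB.instance Definition _ := [Choice of l2 by <:].
HB.instance Definition _ := [SubChoice_isSubLmodule of l2 by <:].

Lemma l2DE (x y : l2) i : (x + y) i = x i + y i. Proof. by []. Qed.
Lemma l2BE (x y : l2) i : (x - y) i = x i - y i. Proof. by []. Qed.
Lemma l2ZE (a : R) (x : l2) i : (a *: x) i = a *: x i. Proof. by []. Qed.

Definition l2dot (x y : l2) : R := limn (series (fun i => dot2 (x i) (y i))).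

Lemma l2dot_cvg (x y : l2) : cvgn (series (fun i => dot2 (x i) (y i))).
Proof.
have [/asboolP sx /asboolP sy] := (l2P x, l2P y).
apply: normed_cvg.
pose v := (fun i => dot2 (x i) (x i)) + (fun i => dot2 (y i) (y i)).
apply: (@series_le_cvg _ _ v) => [i|i|i|]; last exact: is_cvg_seriesD.
- exact: normr_ge0.
- by rewrite /v addr_ge0// dot2_ge0.
- rewrite /v /= !fctE ler_norml /dot2.
  have h1 := sqr_ge0 ((x i).1 - (y i).1).
  have h2 := sqr_ge0 ((x i).2 - (y i).2).
  have h3 := sqr_ge0 ((x i).1 + (y i).1).
  have h4 := sqr_ge0 ((x i).2 + (y i).2).
  by apply/andP; split; nra.
Qed.

Fact l2dotC x y : l2dot x y = l2dot y x.
Proof.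
rewrite /l2dot; congr (limn (series _)); apply/funext => i.
by rewrite /dot2 mulrC [X in _ + X]mulrC.
Qed.

Fact l2dotDl x y z : l2dot (x + y) z = l2dot x z + l2dot y z.
Proof.
rewrite /l2dot -lim_seriesD; [|exact: l2dot_cvg..].
by congr (limn (series _)); apply/funext => i; rewrite l2DE /dot2/= !mulrDl addrACA.
Qed.

Fact l2dotZl a x y : l2dot (a *: x) y = a * l2dot x y.
Proof.
rewrite /l2dot (_ : (fun _ => _) = a *: (fun i => dot2 (x i) (y i))).
  by rewrite lim_seriesZ//; exact: l2dot_cvg.
by apply/funext => i; rewrite l2ZE /dot2 /= -!mulrA -mulrDr.
Qed.

Lemma series_le_l2dot (x : l2) n :
  \sum_(0 <= i < n) dot2 (x i) (x i) <= l2dot x x.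
Proof.
apply: (@nondecreasing_cvgn_le _ (series (fun i => dot2 (x i) (x i)))).
  by apply: nondecreasing_series => i _ _; exact: dot2_ge0.
exact: l2dot_cvg.
Qed.

Lemma dot2_le_l2dot (x : l2) i : dot2 (x i) (x i) <= l2dot x x.
Proof.
apply: le_trans (series_le_l2dot x i.+1); rewrite big_nat_recr//= lerDr.
by apply: sumr_ge0 => j _; exact: dot2_ge0.
Qed.

Lemma l2dot_ge0 x : 0 <= l2dot x x.
Proof. by have := series_le_l2dot x 0; rewrite big_geq. Qed.

Lemma l2dot_sq_le x y : l2dot x y ^+ 2 <= l2dot x x * l2dot y y.
Proof.
set a := l2dot x x; set b := l2dot x y; set c := l2dot y y.
have pos (t : R) : 0 <= a + 2 * t * b + t ^+ 2 * c.
  have := l2dot_ge0 (t *: y + x).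
  rewrite l2dotDl l2dotZl ![l2dot _ (_ + _)]l2dotC !l2dotDl !l2dotZl.
  by rewrite [l2dot y x]l2dotC -/a -/b -/c; lra.
have [c0|c0] := eqVneq c 0.
  have h1 := pos (- (a + 1) / (2 * b)).
  have [->|b0] := eqVneq b 0; first by rewrite expr0n/= mulr_ge0 ?l2dot_ge0.
  move: h1; rewrite c0 mulr0 addr0.
  rewrite (_ : 2 * (- (a + 1) / (2 * b)) * b = - (a + 1)); last by field.
  lra.
have cgt : 0 < c by rewrite lt_def c0 l2dot_ge0.
have := pos (- b / c).
rewrite (_ : a + _ + _ = (a * c - b ^+ 2) / c); last by field.
by rewrite pmulr_lge0 ?invr_gt0// subr_ge0.
Qed.

Definition l2norm x : R := Num.sqrt (l2dot x x).

Fact l2norm_sq x : l2norm x ^+ 2 = l2dot x x.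
Proof. by rewrite sqr_sqrtr// l2dot_ge0. Qed.

Fact l2normD x y : l2norm (x + y) <= l2norm x + l2norm y.
Proof.
rewrite -ler_sqr ?nnegrE ?addr_ge0 ?sqrtr_ge0// sqrrD !l2norm_sq.
rewrite l2dotDl ![l2dot _ (_ + _)]l2dotC !l2dotDl [l2dot y x]l2dotC.
suff : l2dot x y <= l2norm x * l2norm y by rewrite mulr2n; lra.
rewrite -sqrtrM ?l2dot_ge0// (le_trans (ler_norm _))// -sqrtr_sqr.
by rewrite ler_wsqrtr// l2dot_sq_le.
Qed.

Fact l2normZ a x : l2norm (a *: x) = `|a| * l2norm x.
Proof.
rewrite /l2norm l2dotZl l2dotC l2dotZl mulrA -expr2 sqrtrM ?sqr_ge0//.
by rewrite sqrtr_sqr.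
Qed.

Fact l2norm0_eq0 x : l2norm x = 0 -> x = 0.
Proof.
move=> /eqP; rewrite sqrtr_eq0 => x0; apply/val_inj/funext => i /=.
have := le_trans (dot2_le_l2dot x i) x0; rewrite /dot2 -!expr2 => h.
have := sqr_ge0 (x i).1; have := sqr_ge0 (x i).2 => h2 h1.
have /eqP e1 : (x i).1 ^+ 2 == 0 by rewrite eq_le; lra.
have /eqP e2 : (x i).2 ^+ 2 == 0 by rewrite eq_le; lra.
move: e1 e2 => /eqP; rewrite sqrf_eq0 => /eqP e1 /eqP.
by rewrite sqrf_eq0 => /eqP e2; rewrite [LHS]surjective_pairing e1 e2.
Qed.

HB.instance Definition _ :=
  Lmodule_isNormed.Build R l2 l2normD l2normZ l2norm0_eq0.

Fact l2dotxx (x : l2) : l2dot x x = `|x| ^+ 2.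
Proof. by rewrite -l2norm_sq. Qed.

Lemma l2_coord_le (x : l2) i : `|(x i).1| <= `|x| /\ `|(x i).2| <= `|x|.
Proof.
have h := dot2_le_l2dot x i; rewrite l2dotxx in h.
split; rewrite -ler_sqr ?nnegrE ?normr_ge0// (le_trans _ h)//= /dot2 real_normK ?num_real//.
- by have := sqr_ge0 (x i).2; rewrite -!expr2; lra.
- by have := sqr_ge0 (x i).1; rewrite -!expr2; lra.
Qed.

Fact l2_complete (F : set_system l2) : ProperFilter F -> cauchy F -> cvg F.
Proof.
move=> FF Fc.
have Fb : cauchy_ball F by apply/cauchy_ballP.
have cvg_coord (p : l2 -> R) : (forall x y, `|p x - p y| <= `|x - y|) ->
    cvg (p x @[x --> F]).
  move=> pL; apply: R_complete; apply: cauchy_exP => e e0.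
  have [z Fz] := (cauchyP F).1 Fc e e0.
  exists (p z); rewrite /= /fmap/= /nbhs/=; apply: filterS Fz => y.
  rewrite -!ball_normE /ball_/= => zy.
  exact: le_lt_trans zy.
pose p1 i (x : l2) := (x i).1; pose p2 i (x : l2) := (x i).2.
pose s i := (lim (p1 i x @[x --> F]), lim (p2 i x @[x --> F])).
have c1 i : p1 i x @[x --> F] --> (s i).1.
  by apply: cvg_coord => x y; exact: (l2_coord_le (x - y) i).1.
have c2 i : p2 i x @[x --> F] --> (s i).2.
  by apply: cvg_coord => x y; exact: (l2_coord_le (x - y) i).2.
have csum (x : l2) n : (\sum_(0 <= i < n) dot2 ((x - y) i) ((x - y) i)) @[y --> F]
    --> \sum_(0 <= i < n) dot2 (x i - s i) (x i - s i).
  elim: n => [|n IH].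
    rewrite big_geq//; under eq_fun do rewrite big_geq//; exact: cvg_cst.
  have d1 : ((x n).1 - p1 n y) @[y --> F] --> (x n).1 - (s n).1.
    by apply: cvgB; [exact: cvg_cst|exact: c1].
  have d2 : ((x n).2 - p2 n y) @[y --> F] --> (x n).2 - (s n).2.
    by apply: cvgB; [exact: cvg_cst|exact: c2].
  rewrite big_nat_recr//=; under eq_fun do rewrite big_nat_recr//=.
  exact: (cvgD IH (cvgD (cvgM d1 d1) (cvgM d2 d2))).
have bnd (e : R) : 0 < e -> \forall x \near F, forall n : nat,
    \sum_(0 <= i < n) dot2 ((x : l2) i - s i) ((x : l2) i - s i) <= e ^+ 2.
  move=> e0; have /nearP_dep := Fb e e0.
  apply: filterS => x Fx n.
  apply: cvgr_to_le (csum x n) _.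
  apply: filterS Fx => y; rewrite -ball_normE /=.
  move=> xy; apply: (le_trans (series_le_l2dot (x - y) n)).
  by rewrite l2dotxx ler_sqr ?nnegrE// ?ltW.
have diff (x : l2) (e : R) : (forall n : nat,
    \sum_(0 <= i < n) dot2 (x i - s i) (x i - s i) <= e ^+ 2) ->
    (x : nat -> R * R) - s \in sqsummable.
  move=> h; apply/asboolP; apply: nondecreasing_is_cvgn.
    by apply: nondecreasing_series => i _ _; exact: dot2_ge0.
  by exists (e ^+ 2) => _ [n _ <-]; rewrite /= seriesEnat; exact: h.
have sP : s \in sqsummable.
  have /filter_ex[x hx] := bnd 1 ltr01.
  have dx := diff _ _ hx.
  by rewrite -(subKr (x : nat -> R * R) s) rpredB// l2P.
apply/cvg_ex; exists (L2 sP); apply/cvgrPdist_le => e e0.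
apply: filterS (bnd e e0) => x hx.
rewrite distrC -ler_sqr ?nnegrE ?(ltW e0)// -l2dotxx.
by apply: limr_le; [exact: l2dot_cvg|apply: nearW => n; exact: hx].
Qed.

HB.instance Definition _ := Uniform_isComplete.Build l2 l2_complete.

HB.instance Definition _ := CompleteNormedModule_isHilbert.Build R l2
  l2dotC l2dotDl l2dotZl l2dotxx.

End L2.

Section FDRS.
Variables (R : realType) (H : hilbertType R).
Implicit Types (V C : set H) (f : H -> \bar R) (g : H -> R) (x y z : H).
Implicit Types gamma mu : R.

Definition chi C x : \bar R := (if x \in C then 0 else +oo)%E.

Definition closed_subspace V : Prop :=
  [/\ closed V, V 0 & forall (a : R) x y, V x -> V y -> V (a *: x + y)].

Definition is_proj V x y : Prop :=
  V y /\ forall w, V w -> `|x - y| <= `|x - w|.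

(* The functions orthproj, prox and grad return the junk value 0 when the object
   they select does not exist. *)
Definition orthproj V x : H := xget 0 [set y | is_proj V x y].

Definition is_prox gamma f x y : Prop :=
  forall w, (f y + ((2 * gamma)^-1 * `|y - x| ^+ 2)%:E <=
             f w + ((2 * gamma)^-1 * `|w - x| ^+ 2)%:E)%E.

Definition prox gamma f x : H := xget 0 [set y | is_prox gamma f x y].

Definition is_grad g x y : Prop :=
  differentiable g x /\ forall w, 'd g x w = inner y w.

Definition grad g x : H := xget 0 [set y | is_grad g x y].

Definition subdiff f x : set H :=
  [set u | f x \is a fin_num /\ forall y, (f x + (inner u (y - x))%:E <= f y)%E].

(* For mu = 0 this is convexity. *)
Definition strongly_convex mu f : Prop :=
  forall x y (t : R), 0 <= t <= 1 ->
  (f (t *: x + (1 - t) *: y)%R + (mu / 2 * t * (1 - t) * `|x - y| ^+ 2)%:E <=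
   t%:E * f x + (1 - t)%:E * f y)%E.

Definition closed_proper_convex f : Prop :=
  [/\ lower_semicontinuous f,
      forall x, f x != -oo%E, exists x, f x != +oo%E & strongly_convex 0 f].

Definition refl_prox gamma f x : H := 2 *: prox gamma f x - x.

Definition refl_proj V x : H := 2 *: orthproj V x - x.

Definition fdrs_op gamma f g V z : H :=
  let w := z - gamma *: grad (g \o orthproj V) z in
  2^-1 *: w + 2^-1 *: refl_prox gamma f (refl_proj V w).

Fixpoint fdrs gamma f g V (lambda : nat -> R) z0 (k : nat) : H :=
  if k is j.+1 then
    let z := fdrs gamma f g V lambda z0 j in
    (1 - lambda j) *: z + lambda j *: fdrs_op gamma f g V z
  else z0.

Definition fdrs_xh V (z : nat -> H) (k : nat) : H := orthproj V (z k).

Definition fdrs_xf gamma f g V (z : nat -> H) (k : nat) : H :=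
  prox gamma f (refl_proj V (z k - gamma *: grad (g \o orthproj V) (z k))).

Definition Sf muf betaf f x y : R :=
  if 0 < betaf then
    Num.max (muf / 2 * `|x - y| ^+ 2)
      (betaf / 2 * `|grad (fine \o f) x - grad (fine \o f) y| ^+ 2)
  else muf / 2 * `|x - y| ^+ 2.

Definition Sh mug betaV g V x y : R :=
  Num.max (mug / 2 * `|orthproj V x - orthproj V y| ^+ 2)
    (betaV / 2 * `|grad (g \o orthproj V) x - grad (g \o orthproj V) y| ^+ 2).

(* The hypotheses under which the best-iterate rates O(1/(k+1)) for Sf + Sh and
   o(1/(k+1)) for Sf and Sh are known to hold. *)
Record best_rate_hyps f g V (gamma betaV betaf muf mug eps : R)
    (lambda : nat -> R) : Prop := {
  brh_V : closed_subspace V ;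
  brh_f : closed_proper_convex f ;
  brh_g : closed_proper_convex (EFin \o g) ;
  brh_gdiff : forall x, differentiable g x ;
  brh_glip : exists L : R, L.-lipschitz (grad g) ;
  brh_betaV : 0 < betaV ;
  brh_hlip : betaV^-1.-lipschitz (grad (g \o orthproj V)) ;
  brh_sol : exists x u v,
    [/\ subdiff f x u, subdiff (chi V) x v & u + grad g x + v = 0] ;
  brh_muf : 0 <= muf /\ strongly_convex muf f ;
  brh_mug : 0 <= mug /\ strongly_convex mug (EFin \o g) ;
  brh_betaf : 0 <= betaf ;
  brh_fsmooth : 0 < betaf ->
    [/\ forall x, f x \is a fin_num, forall x, differentiable (fine \o f) x
      & betaf^-1.-lipschitz (grad (fine \o f))] ;
  brh_gamma : 0 < gamma < 2 * betaV ;
  brh_eps : 0 < eps < 1 ;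
  brh_lambda : let alpha0 := 2 * betaV / (4 * betaV - gamma) in
    forall j, 0 < lambda j < (1 - eps) * (1 + eps * alpha0) / alpha0 ;
  brh_inf : 0 < inf (range lambda)
}.

Definition best_iterate (s : nat -> R) (k : nat) : R :=
  \big[Num.min/s 0%N]_(j < k.+1) s j.

(* R-linear convergence, the weakest of the usual notions; so its negation also
   excludes Q-linear convergence. *)
Definition converges_linearly (u : nat -> H) x : Prop :=
  exists C q : R, 0 <= q < 1 /\ forall k, `|u k - x| <= C * q ^+ k.

End FDRS.

Section Example.
Variable R : realType.
Implicit Types (theta : nat -> R) (a : R) (x : l2 R).

Definition rotation (t : R) (u : R * R) : R * R :=
  (cos t * u.1 - sin t * u.2, sin t * u.1 + cos t * u.2).

Definition e0 : R * R := (1, 0).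

Definition line_sum (d : nat -> R * R) : set (l2 R) :=
  [set x | forall i, exists t : R, x i = t *: d i].

Definition exV : set (l2 R) := line_sum (fun=> e0).

Definition exU theta : set (l2 R) := line_sum (fun i => rotation (theta i) e0).

Definition exf theta a x : \bar R :=
  (chi (exU theta) x + (a / 2 * `|x| ^+ 2)%:E)%E.

Definition exg x : R := 2^-1 * `|x| ^+ 2.

Definition exT theta a : l2 R -> l2 R := fdrs_op 1 (exf theta a) exg exV.

Definition exz theta a : l2 R -> nat -> l2 R :=
  fdrs 1 (exf theta a) exg exV (fun=> 1).

Definition exxh theta a (z0 : l2 R) : nat -> l2 R :=
  fdrs_xh exV (exz theta a z0).

Definition exxf theta a (z0 : l2 R) : nat -> l2 R :=
  fdrs_xf 1 (exf theta a) exg exV (exz theta a z0).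

End Example.
Arguments exV {R}.
Arguments exg {R}.

(* Main.v *)
Require Import Defs.
From HB Require Import structures.
From mathcomp Require Import all_boot all_order all_algebra.
From mathcomp Require Import all_classical all_reals all_analysis.
From mathcomp Require Import ring lra.
Import Order.TTheory GRing.Theory Num.Theory.
Import numFieldNormedType.Exports.
Local Open Scope classical_set_scope.
Local Open Scope ring_scope.

(** In each plane [(p, q)] of the direct sum, with [s], [c] the sine and cosine
    of the angle [theta i], the operator [T] acts by
    [(p, q) |-> (- s c / (1 + a) * q, (1 - s ^ 2 / (1 + a)) * q)]: the gradient
    step deletes the component in [V], and the proximal step is the projection
    on [U] scaled by [1 / (1 + a)] ([fdrs_op_quadratic], [exT_coord]).  So the
    second coordinate decays geometrically with ratio
    [r = 1 - s ^ 2 / (1 + a)], and [x_f ^ k], [x_h ^ k.+1] have squared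
    components [s ^ 2 / (1 + a) ^ 2 * r ^ (2 k) * q ^ 2] and [c ^ 2] times this.

    The factor [s ^ 2 / (1 + a)] is [1 - r], and [(1 - r) * r ^ n] is at most
    [1 / n.+1]; summing over the planes, the squared norms of [x_f ^ k] and
    [x_h ^ k] are [O(1 / k)] whatever the starting point is ([exx_cvg]).

    The rate is slow because the ratios accumulate at 1.  The sines are
    [2 ^ - i.+1]: for every [k] some angle has [s ^ 2] of order [1 / k] and still
    [4 k s ^ 2 <= 1] ([scale_of_time]), and by Bernoulli's inequality its ratio
    has not acted much after [k] steps ([exxf_sqnorm_ge]).  Starting from
    [q i] proportional to [s i `^ (2 alpha - 1)], a geometric and so
    square-summable sequence as [alpha > 1 / 2], this single plane has squared
    component of order [s ^ (4 alpha)], that is [k ^ (- 2 alpha)]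
    ([slow_xf], [slow_xh]).  The constants are absorbed by scaling the starting
    point.  A polynomial lower bound excludes linear convergence, and it is
    decreasing in [k], so it passes to the minimum over the first iterates. *)

Set Implicit Arguments.
Unset Strict Implicit.
Unset Printing Implicit Defensive.

(** * Inner product identities *)

Section Inner.
Context {R : realType} {H : hilbertType R}.
Implicit Types (x y z w : H) (a t : R).

Lemma innerDr x y z : inner x (y + z) = inner x y + inner x z.
Proof. by rewrite innerC innerDl !(innerC _ x). Qed.

Lemma innerZr a x y : inner x (a *: y) = a * inner x y.
Proof. by rewrite innerC innerZl innerC. Qed.

Lemma inner0l x : inner 0 x = 0.
Proof. by rewrite -(scale0r 0) innerZl mul0r. Qed.

Lemma innerNl x y : inner (- x) y = - inner x y.
Proof. by rewrite -scaleN1r innerZl mulN1r. Qed.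

Lemma innerNr x y : inner x (- y) = - inner x y.
Proof. by rewrite innerC innerNl innerC. Qed.

Lemma innerBl x y z : inner (x - y) z = inner x z - inner y z.
Proof. by rewrite innerDl innerNl. Qed.

Lemma innerBr x y z : inner x (y - z) = inner x y - inner x z.
Proof. by rewrite innerDr innerNr. Qed.

Definition innerE :=
  (@innerDl R H, innerDr, @innerZl R H, innerZr, innerNl, innerNr).

Lemma sqnormD x y : `|x + y| ^+ 2 = `|x| ^+ 2 + 2 * inner x y + `|y| ^+ 2.
Proof. by rewrite -!innerxx !innerE (innerC y x); ring. Qed.

Lemma inner_eq0P x : (forall w, inner x w = 0) -> x = 0.
Proof.
by move=> /(_ x)/eqP; rewrite innerxx sqrf_eq0 normr_eq0 => /eqP.
Qed.

Lemma inner_le x y : inner x y <= `|x| * `|y|.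
Proof.
have [->|x0] := eqVneq x 0.
  by rewrite inner0l mulr_ge0.
have [->|y0] := eqVneq y 0.
  by rewrite innerC inner0l mulr_ge0.
have x1 : 0 < `|x| by rewrite normr_gt0.
have y1 : 0 < `|y| by rewrite normr_gt0.
have : 0 <= inner (`|y| *: x - `|x| *: y) (`|y| *: x - `|x| *: y).
  by rewrite innerxx sqr_ge0.
rewrite !innerE !innerxx (innerC y x) => h.
have : 0 <= 2 * (`|x| * `|y|) * (`|x| * `|y| - inner x y) by lra.
by rewrite pmulr_rge0 ?subr_ge0// !mulr_gt0.
Qed.

Lemma normr_inner_le x y : `|inner x y| <= `|x| * `|y|.
Proof.
by rewrite ler_norml inner_le andbT lerNl -innerNl -[`|x|]normrN inner_le.
Qed.

Lemma inner_continuous x : continuous (inner x).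
Proof.
move=> y; apply/cvgrPdist_lt => e e0.
have x1 : 0 < `|x| + 1 by rewrite ltr_wpDl.
near=> z.
rewrite -innerBr (le_lt_trans (normr_inner_le _ _))//.
have : `|y - z| < e / (`|x| + 1).
  by near: z; apply: cvgr_dist_lt; rewrite ?divr_gt0//; exact: cvg_id.
rewrite ltr_pdivlMr// => h; apply: le_lt_trans h.
by rewrite mulrC ler_wpM2l// lerDl.
Unshelve. all: by end_near. Qed.

(** For half the squared norm the inequality of 1-strong convexity is an
    equality. *)
Lemma sqnorm_conv t x y :
  `|t *: x + (1 - t) *: y| ^+ 2 + t * (1 - t) * `|x - y| ^+ 2 =
  t * `|x| ^+ 2 + (1 - t) * `|y| ^+ 2.
Proof. by rewrite -!innerxx !innerE (innerC y x); ring. Qed.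

Lemma strongly_convexW (mu nu : R) (f : H -> \bar R) :
  mu <= nu -> strongly_convex nu f -> strongly_convex mu f.
Proof.
move=> munu fcvx x y t /[dup] t01 /andP[t0 t1]; apply: le_trans (fcvx x y t t01).
apply: leeD => //; rewrite lee_fin ler_wpM2r ?sqr_ge0// !ler_wpM2r ?subr_ge0//.
Qed.

End Inner.

(** * Orthogonal projections and quadratic energies on subspaces *)

Section Projection.
Context {R : realType} {H : hilbertType R}.
Variables (V : set H) (P : H -> H).
Hypothesis V_lin : forall (a : R) x y, V x -> V y -> V (a *: x + y).
Hypothesis PV : forall x, V (P x).
Hypothesis P_orth : forall x w, V w -> inner (x - P x) w = 0.
Implicit Types (x y z w : H) (a t : R).

Let V0 : V 0.
Proof. by rewrite -(addNr (P 0)) -scaleN1r; apply: V_lin. Qed.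

Let VB x y : V x -> V y -> V (x - y).
Proof. by move=> Vx Vy; rewrite addrC -scaleN1r; apply: V_lin. Qed.

Let VZ a x : V x -> V (a *: x).
Proof. by move=> Vx; rewrite -[_ *: _]addr0; apply: V_lin. Qed.

(** The membership and orthogonality conditions determine the projection;
    linearity and idempotence follow from this. *)
Lemma foot_unique x y : V y -> (forall w, V w -> inner (x - y) w = 0) -> y = P x.
Proof.
move=> Vy y_orth; apply/subr0_eq/eqP; rewrite -normr_eq0 -sqrf_eq0 -innerxx.
have VyP := VB Vy (PV x).
rewrite {1}(_ : y - P x = (x - P x) - (x - y)).
  by rewrite innerBl P_orth// y_orth// subrr.
by rewrite opprB [RHS]addrC addrA subrK.
Qed.

Lemma proj_id x : V x -> P x = x.
Proof.
move=> Vx; apply/esym/foot_unique => // w _.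
by rewrite subrr inner0l.
Qed.

Lemma projP x : V x <-> P x = x.
Proof. by split=> [/proj_id//|<-]. Qed.

Lemma proj_linear a x y : P (a *: x + y) = a *: P x + P y.
Proof.
apply/esym/foot_unique; first exact: V_lin.
move=> w Vw; rewrite opprD addrACA -scalerBr innerDl innerZl.
by rewrite !P_orth// mulr0 addr0.
Qed.

Lemma projD x y : P (x + y) = P x + P y.
Proof. by rewrite -[x]scale1r proj_linear !scale1r. Qed.

Lemma projZ a x : P (a *: x) = a *: P x.
Proof. by rewrite -[a *: x]addr0 proj_linear (proj_id V0) addr0. Qed.

Lemma projN x : P (- x) = - P x.
Proof. by rewrite -scaleN1r projZ scaleN1r. Qed.

Lemma projB x y : P (x - y) = P x - P y.
Proof. by rewrite projD projN. Qed.

Lemma inner_projl x y : inner (P x) y = inner (P x) (P y).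
Proof.
by apply/eqP; rewrite -subr_eq0 -innerBr innerC P_orth.
Qed.

Lemma proj_pythagoras x w : V w ->
  `|x - w| ^+ 2 = `|x - P x| ^+ 2 + `|P x - w| ^+ 2.
Proof.
move=> Vw; rewrite (_ : x - w = (x - P x) + (P x - w)); last first.
  by rewrite addrA subrK.
by rewrite sqnormD (P_orth _ (VB (PV x) Vw)) mulr0 addr0.
Qed.

Lemma proj_norm x : `|P x| <= `|x|.
Proof.
rewrite -ler_sqr ?nnegrE//; have := proj_pythagoras x V0.
by rewrite !subr0 => ->; rewrite lerDr sqr_ge0.
Qed.

Lemma orthproj_foot x : orthproj V x = P x.
Proof.
have Pmin w : V w -> `|x - P x| <= `|x - w|.
  move=> Vw; rewrite -ler_sqr ?nnegrE// (proj_pythagoras x Vw).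
  by rewrite lerDl sqr_ge0.
apply: xget_unique => // y [Vy ymin].
have : `|x - y| ^+ 2 <= `|x - P x| ^+ 2 by rewrite ler_sqr ?nnegrE// ymin.
rewrite (proj_pythagoras x Vy) gerDl => h.
apply/eqP; rewrite eq_sym -subr_eq0 -normr_eq0 -sqrf_eq0.
by rewrite eq_le h sqr_ge0.
Qed.

Lemma proj_continuous : continuous P.
Proof.
move=> x; apply/cvgrPdist_lt => e e0; near=> y.
by rewrite -projB (le_lt_trans (proj_norm _)).
Unshelve. all: by end_near. Qed.

Lemma proj_closed : closed V.
Proof.
have -> : V = (fun x => P x - x) @^-1` [set 0].
  apply/seteqP; split => x /=; first by move=> /proj_id ->; rewrite subrr.
  by move=> /subr0_eq Px; apply/projP.
apply: closed_comp => [x _|]; last first.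
  exact/accessible_closed_set1/hausdorff_accessible/norm_hausdorff.
by apply: cvgB; [exact: proj_continuous|exact: cvg_id].
Qed.

Lemma proj_closed_subspace : closed_subspace V.
Proof. by split; [exact: proj_closed|exact: V0|exact: V_lin]. Qed.

(** As a projection is self-adjoint and idempotent, the increment of
    [`|P x| ^+ 2 / 2] in the direction [h] is [inner (P x) h] plus
    [`|P h| ^+ 2 / 2], and the latter is negligible as [P] is nonexpansive. *)
Lemma is_grad_sqproj x : is_grad (fun y => 2^-1 * `|P y| ^+ 2) x (P x).
Proof.
pose df : H -> R := inner (P x).
have df_lin : linear df by move=> a y z; rewrite /df innerDr innerZr.
pose D := HB.pack_for {linear H -> R} df (GRing.isLinear.Build _ _ _ _ _ df_lin).
have D_cont : continuous D by exact: inner_continuous.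
set g := fun y => _.
have gE : g \o shift x = cst (g x) + D +o_ 0 id.
  apply/eqaddoP => e e0; near=> h.
  rewrite /= !fctE /= /g projD sqnormD innerC -inner_projl.
  rewrite (_ : _ - _ = 2^-1 * `|P h| ^+ 2); last by rewrite /D/= /df; field.
  rewrite normrM normrX normr_id gtr0_norm ?invr_gt0//.
  have he : `|h| < e by near: h; apply: nbhs0_lt.
  have := proj_norm h.
  have := normr_ge0 (P h); nra.
have dE : 'd g x = D :> (H -> R) by exact: diff_unique.
split; last by move=> w; rewrite dE.
by apply/diff_locallyP; rewrite dE.
Unshelve. all: by end_near. Qed.

Lemma grad_eq (g : H -> R) x y : is_grad g x y -> grad g x = y.
Proof.
move=> gxy; apply: xget_unique => // z [_ gz].
apply/subr0_eq/inner_eq0P => w; rewrite innerBl -gz -gxy.2.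
by rewrite subrr.
Qed.

(** With the whole space for [V] and [a = 1] this is half the squared norm, so
    both [f] and [g] of the example are of this form. *)
Definition subspace_energy a x : \bar R := (chi V x + (a / 2 * `|x| ^+ 2)%:E)%E.

Lemma subspace_energy_in a x : V x -> subspace_energy a x = (a / 2 * `|x| ^+ 2)%:E.
Proof. by move=> Vx; rewrite /subspace_energy /chi mem_set// add0e. Qed.

Lemma subspace_energy_out a x : ~ V x -> subspace_energy a x = +oo%E.
Proof. by move=> Vx; rewrite /subspace_energy /chi memNset. Qed.

(** The point [y = P x / (1 + a)] of [V] makes [x - (1 + a) *: y] orthogonal to
    [V], so completing the square leaves no linear term: the proximal objective
    at [w] in [V] exceeds its value at [y] by [(1 + a) / 2 * `|w - y| ^+ 2]. *)
Lemma prox_subspace_energy a x : 0 <= a ->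
  prox 1 (subspace_energy a) x = (1 + a)^-1 *: P x.
Proof.
move=> a0; have a1 : 0 < 1 + a by lra.
set y := _ *: _.
have Vy : V y by exact: VZ.
have y_orth w : V w -> inner (x - (1 + a) *: y) (w - y) = 0.
  by move=> Vw; rewrite /y scalerA divff ?gt_eqF// scale1r P_orth//; exact: VB.
clearbody y.
have gap w : V w -> a / 2 * `|w| ^+ 2 + (2 * 1)^-1 * `|w - x| ^+ 2 =
    a / 2 * `|y| ^+ 2 + (2 * 1)^-1 * `|y - x| ^+ 2 + (1 + a) / 2 * `|w - y| ^+ 2.
  move=> Vw; move: (y_orth _ Vw).
  rewrite -!innerxx !innerE (innerC y w) (innerC x w) (innerC x y).
  lra.
apply: xget_unique => [w|z zmin].
  have [Vw|nVw] := pselect (V w); last first.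
    by rewrite (subspace_energy_out _ nVw) addye ?leey.
  rewrite !subspace_energy_in// -!EFinD lee_fin (gap w)//.
  by rewrite lerDl mulr_ge0 ?sqr_ge0//; lra.
have := zmin y; rewrite (subspace_energy_in _ Vy).
have [Vz|nVz] := pselect (V z); last first.
  by rewrite (subspace_energy_out _ nVz) addye// -EFinD leye_eq.
rewrite subspace_energy_in// -!EFinD lee_fin (gap z)// gerDl.
rewrite pmulr_rle0; last by lra.
move=> h; apply/subr0_eq/eqP; rewrite -normr_eq0 -sqrf_eq0.
by rewrite eq_le h sqr_ge0.
Qed.

Lemma subspace_energy_lsc a : 0 <= a -> lower_semicontinuous (subspace_energy a).
Proof.
move=> a0 x b.
have [Vx|nVx] := pselect (V x).
  rewrite subspace_energy_in// lte_fin => bx.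
  exists [set y | b < a / 2 * `|y| ^+ 2] => [|y /= by_].
    have : (fun y : H => a / 2 * `|y| ^+ 2) @ x --> a / 2 * `|x| ^+ 2.
      apply: cvgM; first exact: cvg_cst.
      by rewrite !expr2; apply: cvgM; apply: cvg_norm; exact: cvg_id.
    by move=> /cvgr_gt; apply.
  have [Vy|nVy] := pselect (V y); last by rewrite subspace_energy_out// ltry.
  by rewrite subspace_energy_in// lte_fin.
move=> _; exists (~` V) => [|y /= nVy]; last by rewrite subspace_energy_out// ltry.
by apply: open_nbhs_nbhs; split => //; rewrite openC; exact: proj_closed.
Qed.

Lemma subspace_energy_strongly_convex a : 0 <= a ->
  strongly_convex a (subspace_energy a).
Proof.
move=> a0 x y t /andP[t0 t1].
(* At the endpoints a weight 0 multiplies a possibly infinite value. *)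
have [->|tn0] := eqVneq t 0.
  by rewrite scale0r add0r subr0 scale1r mulr0 !mul0r mul0e add0e adde0 mul1e.
have [->|tn1] := eqVneq t 1.
  by rewrite subrr scale0r addr0 scale1r mulr0 !mul0r mul0e adde0 adde0 mul1e.
have {}t0 : 0 < t by rewrite lt_def tn0.
have {}t1 : 0 < 1 - t by rewrite subr_gt0 lt_def eq_sym tn1.
have [Vx|nVx] := pselect (V x); last first.
  rewrite (subspace_energy_out _ nVx) gt0_muley ?lte_fin// addye ?leey//.
  have [Vy|nVy] := pselect (V y); first by rewrite subspace_energy_in.
  by rewrite subspace_energy_out// gt0_muley ?lte_fin.
have [Vy|nVy] := pselect (V y); last first.
  rewrite (subspace_energy_out _ nVy) gt0_muley ?lte_fin//.
  by rewrite (subspace_energy_in _ Vx) addey ?leey.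
rewrite !subspace_energy_in//; last by apply: V_lin => //; exact: VZ.
rewrite -!EFinM -!EFinD lee_fin.
by have := sqnorm_conv t x y; nra.
Qed.

End Projection.

(** * The FDRS step for quadratic energies on two subspaces *)

Section QuadraticStep.
Context {R : realType} {H : hilbertType R}.
Variables (V U : set H) (P Q : H -> H) (a : R).
Hypothesis V_lin : forall (t : R) x y, V x -> V y -> V (t *: x + y).
Hypothesis PV : forall x, V (P x).
Hypothesis P_orth : forall x w, V w -> inner (x - P x) w = 0.
Hypothesis U_lin : forall (t : R) x y, U x -> U y -> U (t *: x + y).
Hypothesis QU : forall x, U (Q x).
Hypothesis Q_orth : forall x w, U w -> inner (x - Q x) w = 0.
Hypothesis a0 : 0 <= a.

Local Notation f := (subspace_energy U a).
Local Notation g := (fun x : H => 2^-1 * `|x| ^+ 2).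

Lemma grad_sqproj z : grad (g \o orthproj V) z = P z.
Proof.
apply: grad_eq; rewrite (_ : _ \o _ = fun y => 2^-1 * `|P y| ^+ 2).
  exact: (is_grad_sqproj V_lin).
by apply/funext => y; rewrite /= (orthproj_foot V_lin PV P_orth).
Qed.

(** Since [P (z - P z) = 0], reflecting [z - P z] across [V] only changes its
    sign; the forward step has erased the component of [z] in [V]. *)
Lemma backward_step z :
  prox 1 f (refl_proj V (z - 1 *: grad (g \o orthproj V) z)) =
  - ((1 + a)^-1 *: Q (z - P z)).
Proof.
rewrite grad_sqproj scale1r /refl_proj (orthproj_foot V_lin PV P_orth).
have -> : P (z - P z) = 0.
  by rewrite (projB V_lin PV P_orth) (proj_id V_lin PV P_orth (PV z)) subrr.
rewrite scaler0 sub0r (prox_subspace_energy U_lin QU Q_orth)//.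
by rewrite (projN U_lin QU Q_orth) scalerN.
Qed.

Lemma fdrs_op_quadratic z :
  fdrs_op 1 f g V z = (z - P z) - (1 + a)^-1 *: Q (z - P z).
Proof.
rewrite /fdrs_op /refl_prox backward_step grad_sqproj.
rewrite /refl_proj (orthproj_foot V_lin PV P_orth) scale1r.
have -> : P (z - P z) = 0.
  by rewrite (projB V_lin PV P_orth) (proj_id V_lin PV P_orth (PV z)) subrr.
rewrite scaler0 sub0r opprK; move: (z - P z) => w; move: (_ *: Q w) => u.
rewrite scalerDr scalerA mulVf// scale1r addrCA addrC -scalerDl.
by rewrite -[2^-1]div1r -splitr scale1r.
Qed.

Lemma sqnorm_energy : EFin \o g = subspace_energy setT 1.
Proof. by apply/funext => x; rewrite subspace_energy_in//= div1r. Qed.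

Lemma is_grad_sqnorm (x : H) : is_grad g x x.
Proof.
apply: (@is_grad_sqproj _ _ setT id) => // y w _.
by rewrite subrr inner0l.
Qed.

Lemma subspace_energy_closed_proper_convex (W : set H) (S : H -> H) b :
  (forall (t : R) x y, W x -> W y -> W (t *: x + y)) -> (forall x, W (S x)) ->
  (forall x w, W w -> inner (x - S x) w = 0) -> 0 <= b ->
  closed_proper_convex (subspace_energy W b).
Proof.
move=> W_lin WS S_orth b0; split.
- exact: (subspace_energy_lsc W_lin WS S_orth).
- move=> x; have [Wx|nWx] := pselect (W x).
    by rewrite subspace_energy_in.
  by rewrite subspace_energy_out.
- by exists (S 0); rewrite subspace_energy_in.
- apply: (strongly_convexW b0).
  exact: (subspace_energy_strongly_convex W_lin).
Qed.

(** The constant [1/10] serves as [eps]: the upper bound on the relaxation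
    parameters is then 36/25, above their common value 1. *)
Lemma best_rate_hyps_quadratic : best_rate_hyps f g V 1 1 0 a 1 10^-1 (fun=> 1).
Proof.
have T_orth (x w : H) : setT w -> inner (x - id x) w = 0.
  by move=> _; rewrite subrr inner0l.
have V0 : V 0 by have [] := proj_closed_subspace V_lin PV P_orth.
have U0 : U 0 by have [] := proj_closed_subspace U_lin QU Q_orth.
split=> //.
- exact: (proj_closed_subspace V_lin PV P_orth).
- exact: (subspace_energy_closed_proper_convex U_lin QU Q_orth).
- by rewrite sqnorm_energy; apply: (@subspace_energy_closed_proper_convex _ id).
- by move=> x; have [] := is_grad_sqnorm x.
- exists 1 => -[x y] _ /=.
  by rewrite !(grad_eq (is_grad_sqnorm _)) mul1r.
- move=> [x y] _ /=; rewrite !grad_sqproj invr1 mul1r.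
  rewrite -(projB V_lin PV P_orth); exact: (proj_norm V_lin PV P_orth).
- exists 0, 0, 0; split; last by rewrite (grad_eq (is_grad_sqnorm _)) !addr0.
  + split; first by rewrite subspace_energy_in.
    move=> y; rewrite subspace_energy_in// normr0 expr0n/= mulr0.
    rewrite inner0l add0e.
    have [Uy|nUy] := pselect (U y); last by rewrite subspace_energy_out ?leey.
    by rewrite subspace_energy_in// lee_fin mulr_ge0 ?sqr_ge0 ?divr_ge0.
  + split; first by rewrite /chi mem_set.
    move=> y; rewrite /chi mem_set// inner0l adde0.
    by case: ifP.
- by split=> //; exact: (subspace_energy_strongly_convex U_lin QU).
- split=> //; rewrite sqnorm_energy.
  exact: (@subspace_energy_strongly_convex _ _ _ id).
- by rewrite ltxx.
- by rewrite mulr1 ltr01 ltr1n.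
- by rewrite invr_gt0 invf_lt1 ltr0n ?ltr1n.
- move=> alpha0 j; rewrite ltr01 /=.
  rewrite (_ : _ / alpha0 = 36 / 25); first by lra.
  by rewrite /alpha0; field.
- rewrite (_ : range _ = [set 1]) ?inf1//.
  by apply/seteqP; split=> [_ [_ _ <-]//|_ ->]; exists 0%N.
Qed.

End QuadraticStep.

(** * Comparison of norms and projections on line sums in the direct sum *)

Section L2Facts.
Context {R : realType}.
Implicit Types (x y : l2 R) (d s : nat -> R * R).

Lemma sqsummable_le s x : (forall i, dot2 (s i) (s i) <= dot2 (x i) (x i)) ->
  s \in @sqsummable R.
Proof.
move=> sx; apply/asboolP; apply: series_le_cvg sx _ => [i|i|].
- exact: dot2_ge0.
- exact: dot2_ge0.
- exact: l2dot_cvg.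
Qed.

Lemma l2_sqnorm_le (C : R) x y :
  (forall i, dot2 (x i) (x i) <= C * dot2 (y i) (y i)) -> 0 <= C ->
  `|x| ^+ 2 <= C * `|y| ^+ 2.
Proof.
move=> xy C0; rewrite -!l2dotxx.
apply: limr_le; first exact: l2dot_cvg.
apply: nearW => n; rewrite seriesEnat.
apply: (@le_trans _ _ (C * \sum_(0 <= i < n) dot2 (y i) (y i))).
  by rewrite mulr_sumr; apply: ler_sum => i _; exact: xy.
by rewrite ler_wpM2l// series_le_l2dot.
Qed.

Lemma l2_coord_sqnorm x i : dot2 (x i) (x i) <= `|x| ^+ 2.
Proof. by rewrite -l2dotxx dot2_le_l2dot. Qed.

Lemma pair_scaleE (t u v : R) : t *: (u, v) = (t * u, t * v) :> (R * R)%type.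
Proof. by []. Qed.

Lemma l2_ext x y : (forall i, x i = y i) -> x = y.
Proof. by move=> xy; apply/val_inj/funext. Qed.

Lemma line_sum_linear d (t : R) x y :
  line_sum d x -> line_sum d y -> line_sum d (t *: x + y).
Proof.
move=> dx dy i; have [[p xE] [q yE]] := (dx i, dy i).
by exists (t * p + q); rewrite l2DE l2ZE xE yE scalerDl scalerA.
Qed.

Section LineProjection.
Variable d : nat -> R * R.
Hypothesis d_unit : forall i, dot2 (d i) (d i) = 1.

Lemma line_proj_sqsummable x :
  (fun i => dot2 (x i) (d i) *: d i) \in @sqsummable R.
Proof.
apply: (@sqsummable_le _ x) => i; move: (d_unit i).
move: (x i) (d i) => [p q] [u v]; rewrite /dot2/= /GRing.scale/= => uv.
have -> : (p * u + q * v) * u * ((p * u + q * v) * u) +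
   (p * u + q * v) * v * ((p * u + q * v) * v) =
   (p * u + q * v) ^+ 2 * (u * u + v * v) by ring.
rewrite uv mulr1 -subr_ge0.
have -> : p * p + q * q - (p * u + q * v) ^+ 2 =
   (p * p + q * q) * (1 - (u * u + v * v)) + (p * v - q * u) ^+ 2 by ring.
by rewrite uv subrr mulr0 add0r sqr_ge0.
Qed.

Definition line_proj x : l2 R := L2 (line_proj_sqsummable x).

Lemma line_projE x i : line_proj x i = dot2 (x i) (d i) *: d i.
Proof. by []. Qed.

Lemma line_proj_mem x : line_sum d (line_proj x).
Proof. by move=> i; exists (dot2 (x i) (d i)). Qed.

Lemma line_proj_orth x w : line_sum d w -> inner (x - line_proj x) w = 0.
Proof.
move=> dw; rewrite -[LHS]/(l2dot _ _) /l2dot (_ : (fun _ => _) = cst 0).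
  rewrite (_ : series _ = cst 0) ?lim_cst//.
  by apply/funext => n; rewrite seriesEnat/= big1.
apply/funext => i; rewrite l2BE line_projE; have [t ->] := dw i.
have := d_unit i; move: (x i) (d i) => [p q] [u v].
rewrite /dot2/= /GRing.scale/= => uv.
have -> : (p - (p * u + q * v) * u) * (t * u) + (q - (p * u + q * v) * v) * (t * v)
  = t * (p * u + q * v) * (1 - (u * u + v * v)) by ring.
by rewrite uv subrr mulr0.
Qed.

End LineProjection.
End L2Facts.

(** * Elementary rates *)

Section Rates.
Context {R : realType}.

(** [r ^+ n] is the smallest of the [n.+1] terms of [\sum_(i < n.+1) r ^+ i],
    and the product of this sum with [1 - r] telescopes to [1 - r ^+ n.+1]. *)
Lemma geometric_mean_le (r : R) n : 0 <= r <= 1 -> (1 - r) * r ^+ n <= n.+1%:R^-1.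
Proof.
move=> /andP[r0 r1]; rewrite -[n.+1%:R^-1]mul1r ler_pdivlMr ?ltr0n// -mulrA.
apply: (@le_trans _ _ ((1 - r) * \sum_(i < n.+1) r ^+ i)).
  rewrite ler_wpM2l ?subr_ge0// mulr_natr -[X in _ *+ X]card_ord -sumr_const.
  by apply: ler_sum => i _; apply: ler_wiXn2l => //; rewrite -ltnS.
rewrite -opprB mulNr -subrX1 opprB gerBl; exact: exprn_ge0.
Qed.

Lemma powR_exprC (x p : R) n : 0 <= x -> x `^ p ^+ n = (x ^+ n) `^ p.
Proof. by move=> x0; rewrite -powR_mulrn ?powR_ge0// powRAC powR_mulrn. Qed.

Lemma bernoulli_le (x : R) n : 0 <= x <= 1 -> 1 - n%:R * x <= (1 - x) ^+ n.
Proof.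
move=> /andP[x0 x1]; elim: n => [|n IH]; first by rewrite mul0r subr0 expr0.
rewrite exprS (@le_trans _ _ ((1 - x) * (1 - n%:R * x)))//; last first.
  by rewrite ler_wpM2l ?subr_ge0.
have n0 : 0 <= n%:R :> R by [].
rewrite -natr1; have := mulr_ge0 n0 (sqr_ge0 x); nra.
Qed.

Lemma cvg0_of_sqnorm_le (H : hilbertType R) (u : nat -> H) (C : R) :
  (forall k, `|u k| ^+ 2 <= C / k.+1%:R) -> u @ \oo --> (0 : H).
Proof.
move=> uC; apply/cvgr0Pnorm_le => e e0.
have : (C * (@harmonic R) n) @[n --> \oo] --> C * 0.
  by apply: cvgM; [exact: cvg_cst|exact: cvg_harmonic].
rewrite mulr0 => /cvgrPdist_le/(_ _ (exprn_gt0 2 e0)); apply: filterS => k.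
rewrite sub0r normrN /= => Ck.
rewrite -ler_sqr ?nnegrE ?(ltW e0)//.
by rewrite (le_trans (uC k))// (le_trans (ler_norm _)).
Qed.

(** If [`|u k - x|] were at most [C * q ^+ k], then [k.+1 * q ^+ k] would stay
    away from zero; but with [r = Num.sqrt q] it is at most [r ^+ k / (1 - r)],
    which tends to zero. *)
Lemma not_linear (H : hilbertType R) (u : nat -> H) x :
  (forall k, k.+1%:R ^- 2 <= `|u k - x| ^+ 2) -> ~ converges_linearly u x.
Proof.
move=> ux [C [q [/andP[q0 q1] uq]]].
pose r := Num.sqrt q.
have r0 : 0 <= r by exact: sqrtr_ge0.
have r1 : r < 1 by rewrite -sqrtr1 ltr_sqrt.
have C0 : 0 <= C by have := uq 0%N; rewrite expr0 mulr1; apply: le_trans.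
have lb k : 1 <= C / (1 - r) * r ^+ k.
  have k0 : 0 < k.+1%:R :> R by rewrite ltr0n.
  have h : k.+1%:R^-1 <= `|u k - x|.
    by rewrite -ler_sqr ?nnegrE ?invr_ge0// exprVn.
  have := le_trans h (uq k); rewrite -{1}[k.+1%:R^-1]mul1r ler_pdivrMr//.
  move/le_trans; apply.
  have -> : q ^+ k = r ^+ k * r ^+ k by rewrite -exprMn -expr2 sqr_sqrtr.
  have rk : r ^+ k * k.+1%:R <= (1 - r)^-1.
    rewrite -ler_pdivlMr// ler_pdivlMl ?subr_gt0//.
    by apply: geometric_mean_le; rewrite r0 ltW.
  have := ler_wpM2l (mulr_ge0 C0 (exprn_ge0 k r0)) rk.
  by rewrite !mulrA (mulrAC C (r ^+ k) (1 - r)^-1).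
have : (C / (1 - r) * r ^+ k) @[k --> \oo] --> C / (1 - r) * 0.
  by apply: cvgM; [exact: cvg_cst|apply: cvg_expr; rewrite ger0_norm].
rewrite mulr0 => /cvgr_to_ge/(_ (nearW _ lb)).
by rewrite ler10.
Qed.

End Rates.

(** * Planewise dynamics of the example *)

Section Dynamics.
Context {R : realType}.
Variables (a : R) (theta : nat -> R).
Hypothesis a0 : 0 <= a.
Implicit Types (z : l2 R) (k i : nat).

Local Notation s i := (sin (theta i)).
Local Notation c i := (cos (theta i)).
Definition rate i : R := 1 - s i ^+ 2 / (1 + a).

Let a1 : 0 < 1 + a. Proof. by rewrite ltr_pwDl. Qed.

Lemma axis_unit (i : nat) : dot2 (e0 R) (e0 R) = 1.
Proof. by rewrite /dot2 /e0/= mulr1 mulr0 addr0. Qed.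

Lemma rotationE i : rotation (theta i) (e0 R) = (c i, s i).
Proof. by rewrite /rotation /e0/= !mulr1 !mulr0 subr0 addr0. Qed.

Lemma rotated_unit i : dot2 (rotation (theta i) (e0 R)) (rotation (theta i) (e0 R)) = 1.
Proof. by rewrite rotationE /dot2/= -!expr2 cos2Dsin2. Qed.

Local Notation P := (line_proj axis_unit).
Local Notation Q := (line_proj rotated_unit).
Let V_lin : forall (t : R) (x y : l2 R), exV x -> exV y -> exV (t *: x + y) :=
  line_sum_linear (d := fun=> e0 R).
Let PV : forall x, exV (P x) := line_proj_mem axis_unit.
Let P_orth : forall x w, exV w -> inner (x - P x) w = 0 := line_proj_orth axis_unit.
Let U_lin : forall (t : R) (x y : l2 R),
    exU theta x -> exU theta y -> exU theta (t *: x + y) :=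
  line_sum_linear (d := fun i => rotation (theta i) (e0 R)).
Let QU : forall x, exU theta (Q x) := line_proj_mem rotated_unit.
Let Q_orth : forall x w, exU theta w -> inner (x - Q x) w = 0 :=
  line_proj_orth rotated_unit.

Lemma orthproj_exV z i : orthproj exV z i = ((z i).1, 0).
Proof.
rewrite (orthproj_foot V_lin PV P_orth) line_projE pair_scaleE /dot2 /e0/=.
by rewrite !mulr1 !mulr0 addr0.
Qed.

Lemma proj_residual z i : (z - P z) i = (0, (z i).2).
Proof.
rewrite l2BE line_projE pair_scaleE /dot2 /e0/= !mulr1 !mulr0 addr0.
by case: (z i) => p q; congr pair; rewrite /= ?subrr ?subr0.
Qed.

Lemma backward_coord z i :
  ((1 + a)^-1 *: Q (z - P z)) i =
  (s i / (1 + a) * (z i).2) *: (c i, s i).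
Proof.
rewrite l2ZE line_projE proj_residual rotationE scalerA /dot2/= mul0r add0r.
by congr (_ *: _); rewrite mulrC [_ * s i]mulrC mulrAC.
Qed.

Lemma exT_coord z i : exT theta a z i =
  (- (s i * c i / (1 + a) * (z i).2), rate i * (z i).2).
Proof.
rewrite /exT (fdrs_op_quadratic V_lin PV P_orth U_lin QU Q_orth a0).
rewrite l2BE proj_residual backward_coord pair_scaleE.
by congr pair; rewrite /= /rate; field; rewrite gt_eqF.
Qed.

Lemma exxf_coord z0 k i : exxf theta a z0 k i =
  (- (s i / (1 + a) * (exz theta a z0 k i).2)) *: (c i, s i).
Proof.
rewrite /exxf /fdrs_xf (backward_step V_lin PV P_orth U_lin QU Q_orth a0).
rewrite -[- _ in LHS]sub0r l2BE -[(0 : l2 R) i]/(0 : R * R) sub0r.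
by rewrite backward_coord scaleNr.
Qed.

Lemma exzS z0 k : exz theta a z0 k.+1 = exT theta a (exz theta a z0 k).
Proof. by rewrite /exz /= subrr scale0r add0r scale1r. Qed.

Lemma exz_snd z0 k i : (exz theta a z0 k i).2 = rate i ^+ k * (z0 i).2.
Proof.
elim: k => [|k IH]; first by rewrite mul1r.
by rewrite exzS exT_coord /= IH mulrA exprS.
Qed.

Lemma exxf_sqnorm_coord z0 k i :
  dot2 (exxf theta a z0 k i) (exxf theta a z0 k i) =
  s i ^+ 2 / (1 + a) ^+ 2 * rate i ^+ k.*2 * (z0 i).2 ^+ 2.
Proof.
rewrite exxf_coord exz_snd pair_scaleE /dot2/=.
rewrite -addnn exprD.
have -> : forall t, - t * c i * (- t * c i) + - t * s i * (- t * s i) =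
   t ^+ 2 * (c i ^+ 2 + s i ^+ 2) by move=> t; ring.
by rewrite cos2Dsin2 mulr1; field; rewrite gt_eqF.
Qed.

Lemma exxh_coord z0 k i : exxh theta a z0 k i = ((exz theta a z0 k i).1, 0).
Proof. exact: orthproj_exV. Qed.

Lemma orthproj_exV_idem z : orthproj exV (orthproj exV z) = orthproj exV z.
Proof.
by rewrite !(orthproj_foot V_lin PV P_orth) (proj_id V_lin PV P_orth (PV z)).
Qed.

Lemma orthproj_exxh z0 k : orthproj exV (exxh theta a z0 k) = exxh theta a z0 k.
Proof. exact: orthproj_exV_idem. Qed.

Lemma exxhS_sqnorm_coord z0 k i :
  dot2 (exxh theta a z0 k.+1 i) (exxh theta a z0 k.+1 i) =
  c i ^+ 2 * dot2 (exxf theta a z0 k i) (exxf theta a z0 k i).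
Proof.
rewrite exxf_sqnorm_coord exxh_coord exzS exT_coord exz_snd /dot2/= mulr0 addr0.
by rewrite -addnn exprD; field; rewrite gt_eqF.
Qed.

Let rate01 i : 0 <= rate i <= 1.
Proof.
have s0 := sqr_ge0 (s i); have s1 : s i ^+ 2 <= 1.
  by rewrite -(cos2Dsin2 (theta i)) lerDr sqr_ge0.
rewrite /rate subr_ge0 ler_pdivrMr// gerBl divr_ge0// ?(ltW a1)// andbT.
by rewrite mul1r (le_trans s1)// lerDl.
Qed.

(** The coordinate with contraction factor [rate i] carries the weight
    [1 - rate i], and [(1 - r) * r ^+ n] is at most [1 / n.+1] for every [r] in
    [0, 1]: this gives a bound uniform in [i], even when the rates
    accumulate at 1. *)
Lemma exxf_sqnorm_le z0 k : `|exxf theta a z0 k| ^+ 2 <= k.+1%:R^-1 * `|z0| ^+ 2.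
Proof.
apply: l2_sqnorm_le => [i|]; last by rewrite invr_ge0.
rewrite exxf_sqnorm_coord.
have -> : s i ^+ 2 / (1 + a) ^+ 2 = (1 + a)^-1 * (1 - rate i).
  by rewrite /rate; field; rewrite gt_eqF.
have [r0 r1] := andP (rate01 i).
have ia : 0 <= (1 + a)^-1 <= 1.
  by rewrite invr_ge0 (ltW a1) invf_le1// lerDl.
have h : (1 - rate i) * rate i ^+ k.*2 <= k.+1%:R^-1.
  apply: le_trans (geometric_mean_le _ (rate01 i)) _.
  by rewrite lef_pV2 ?posrE ?ltr0n// ler_nat ltnS -addnn leq_addr.
have g0 : 0 <= (1 - rate i) * rate i ^+ k.*2.
  by rewrite mulr_ge0 ?subr_ge0 ?exprn_ge0.
apply: (@le_trans _ _ (k.+1%:R^-1 * (z0 i).2 ^+ 2)).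
  rewrite ler_wpM2r ?sqr_ge0// -mulrA (le_trans _ h)// ler_piMl//.
  by case/andP: ia.
rewrite ler_wpM2l ?invr_ge0// /dot2 -!expr2 lerDr sqr_ge0//.
Qed.

Lemma exxhS_sqnorm_le z0 k :
  `|exxh theta a z0 k.+1| ^+ 2 <= `|exxf theta a z0 k| ^+ 2.
Proof.
rewrite -[leRHS]mul1r; apply: l2_sqnorm_le => // i.
by rewrite exxhS_sqnorm_coord ler_wpM2r ?dot2_ge0.
Qed.

Lemma orthproj_exV0 : orthproj (@exV R) 0 = 0.
Proof. by apply: l2_ext => i; rewrite orthproj_exV. Qed.

Lemma exx_cvg z0 :
  exxh theta a z0 @ \oo --> (0 : l2 R) /\ exxf theta a z0 @ \oo --> (0 : l2 R).
Proof.
split; [rewrite -cvg_shiftS|]; apply: (@cvg0_of_sqnorm_le _ _ _ (`|z0| ^+ 2)) => k;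
  rewrite mulrC.
- exact: le_trans (exxhS_sqnorm_le _ _) (exxf_sqnorm_le _ _).
- exact: exxf_sqnorm_le.
Qed.

Lemma exT_fixed z : (forall i, s i != 0) -> exT theta a z = z <-> z = 0.
Proof.
move=> s_neq0; split=> [Tz|->]; last first.
  by apply: l2_ext => i; rewrite exT_coord /= !mulr0 oppr0.
apply: l2_ext => i; have := exT_coord z i; rewrite Tz.
move: (z i) => [p q] [pE qE]; move: pE.
have /eqP : s i ^+ 2 / (1 + a) * q = 0 by move: qE; rewrite /rate/=; lra.
have s2 : s i ^+ 2 / (1 + a) != 0.
  by apply: mulf_neq0; [exact: expf_neq0|rewrite invr_eq0 gt_eqF].
rewrite mulf_eq0 (negbTE s2) => /eqP ->.
by rewrite /= mulr0 oppr0 => ->.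
Qed.

Lemma best_rate_hyps_example :
  best_rate_hyps (exf theta a) exg exV 1 1 0 a 1 10^-1 (fun=> 1).
Proof. exact: (best_rate_hyps_quadratic V_lin PV P_orth U_lin QU Q_orth a0). Qed.

(** Bernoulli's inequality bounds [rate i ^+ k.*2] below by 1/2 as long as
    [k] is at most [1 / (4 * s i ^+ 2)]. *)
Lemma exxf_sqnorm_ge z0 k i : 4 * k%:R * s i ^+ 2 <= 1 ->
  (s i * (z0 i).2) ^+ 2 / (2 * (1 + a) ^+ 2) <= `|exxf theta a z0 k| ^+ 2 /\
  c i ^+ 2 * ((s i * (z0 i).2) ^+ 2 / (2 * (1 + a) ^+ 2)) <=
    `|exxh theta a z0 k.+1| ^+ 2.
Proof.
move=> ks.
have coord : (s i * (z0 i).2) ^+ 2 / (2 * (1 + a) ^+ 2) <=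
    dot2 (exxf theta a z0 k i) (exxf theta a z0 k i).
  rewrite exxf_sqnorm_coord.
  have s0 := sqr_ge0 (s i).
  have sa : 0 <= s i ^+ 2 / (1 + a) <= s i ^+ 2.
    by rewrite divr_ge0// ?(ltW a1)// ler_pdivrMr// ler_peMr// lerDl.
  have sa1 : 0 <= s i ^+ 2 / (1 + a) <= 1.
    by have := rate01 i; rewrite /rate; lra.
  have half : 1 / 2 <= rate i ^+ k.*2.
    apply: le_trans (bernoulli_le k.*2 sa1).
    rewrite -muln2 natrM.
    have k0 : 0 <= k%:R :> R by [].
    have [sa0 sas] := andP sa.
    by have := ler_wpM2l k0 sas; lra.
  have -> : (s i * (z0 i).2) ^+ 2 / (2 * (1 + a) ^+ 2) =
      s i ^+ 2 / (1 + a) ^+ 2 * (1 / 2) * (z0 i).2 ^+ 2.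
    by field; rewrite gt_eqF.
  by rewrite ler_wpM2r ?sqr_ge0// ler_wpM2l// divr_ge0 ?sqr_ge0.
split; first exact: le_trans coord (l2_coord_sqnorm _ _).
apply: le_trans (l2_coord_sqnorm _ i); rewrite exxhS_sqnorm_coord.
by rewrite ler_wpM2l ?sqr_ge0.
Qed.

End Dynamics.

(** * Angles with dyadic sines *)

Section DyadicAngles.
Context {R : realType}.

Definition angle (i : nat) : R := asin (2^-1 ^+ i.+1).

Let half_itv i : 0 < (2^-1 : R) ^+ i.+1 <= 2^-1.
Proof.
rewrite exprn_gt0 ?invr_gt0//= exprS ler_piMr ?invr_ge0//.
by rewrite exprn_ile1 ?invr_ge0// invf_le1 ?ler1n.
Qed.

Lemma sin_angle i : sin (angle i) = 2^-1 ^+ i.+1.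
Proof. by have := half_itv i; rewrite /angle => h; rewrite asinK// in_itv/=; lra. Qed.

Lemma angle_itv i : 0 < angle i <= pi / 2.
Proof.
have h := half_itv i; apply/andP; split; last by apply: asin_lepi2; lra.
have pi0 := pi_gt0 R.
rewrite -(@ltr_sin R) ?sin0 ?sin_angle; first by lra.
  by rewrite in_itv/=; lra.
by rewrite in_itv/= asin_geNpi2 ?asin_lepi2//; lra.
Qed.

Lemma angle_cvg : angle @ \oo --> (0 : R).
Proof.
have asin0 : asin (0 : R) = 0.
  by rewrite -[X in asin X]sin0 sinK// in_itv/=; have := pi_gt0 R; lra.
rewrite -[X in _ --> X]asin0.
apply: (@cvg_comp _ _ _ (fun i => (2^-1 : R) ^+ i.+1) (@asin R) _ (nbhs (0 : R))).
  rewrite (cvg_shiftS (fun i => (2^-1 : R) ^+ i)); apply: cvg_expr.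
  by rewrite ger0_norm ?invr_ge0// invf_lt1// ltr1n.
by apply: continuous_asin; lra.
Qed.

(** The squared sines decrease by factors of 4, so for every [k] one of them is
    of order [1 / k.+1]. *)
Lemma scale_of_time k : exists i,
  [/\ 4 * k%:R * sin (angle i) ^+ 2 <= 1, sin (angle i) ^+ 2 <= 1 / 4
    & 1 <= (4 * sin (angle i)) ^+ 2 * k.+1%:R].
Proof.
(* Then [4 * k.+1 < 4 ^ t.+2 <= 16 * k.+1], and [4 ^ t.+2] is the inverse of the
   squared sine. *)
set t := trunc_log 4 k.+1; exists t.+1.
have tl : (4 ^ t <= k.+1)%N by exact: trunc_logP.
have tu : (k.+1 < 4 ^ t.+1)%N by exact: trunc_log_ltn.
have sE : sin (angle t.+1) ^+ 2 = (16 * 4 ^+ t)^-1.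
  rewrite sin_angle -exprM mulnC exprM exprVn exprVn; congr (_^-1).
  by rewrite (_ : 2 ^+ 2 = 4 :> R) ?exprS; ring.
have t0 : 0 < 4 ^+ t :> R by rewrite exprn_gt0.
have {}tl : 4 ^+ t <= k.+1%:R :> R by rewrite -natrX ler_nat.
have {}tu : k.+1%:R <= 4 * 4 ^+ t :> R by rewrite -exprS -natrX ler_nat ltnW.
rewrite exprMn sE; split.
- rewrite ler_pdivrMr ?mulr_gt0// mul1r.
  by move: tu; rewrite -natr1; lra.
- rewrite invf_ple ?posrE ?mulr_gt0//.
  have : 1 <= 4 ^+ t :> R by rewrite exprn_ege1// ler1n.
  rewrite (_ : (1 / 4)^-1 = 4); [lra|by field].
- rewrite invfM mulrA (_ : 4 ^+ 2 / 16 = 1); last by field.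
  by rewrite mul1r mulrC ler_pdivlMr// mul1r.
Qed.

End DyadicAngles.

(** * Starting points with slow convergence *)

Section SlowStart.
Context {R : realType}.
Variables (a alpha : R).
Hypothesis a0 : 0 <= a.
Hypothesis alpha_half : 1 / 2 < alpha.

Local Notation angle := (@angle R).
Local Notation rho := (2^-1 `^ (2 * alpha - 1) : R).
Local Notation K := (2 * (1 + a) * 4 `^ (2 * alpha) : R).

(** As the sine of [angle i] is [2^-1 ^+ i.+1], this is [K] times its power
    with exponent [2 * alpha - 1].  The constant [K] compensates the factors
    [2 * (1 + a) ^+ 2] of [exxf_sqnorm_ge] and [4] of [scale_of_time]. *)
Definition slow_coord (i : nat) : R := K * rho ^+ i.+1.

Let alpha2 : 0 < 2 * alpha - 1. Proof. by move: alpha_half; lra. Qed.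
Let alpha2_gt0 : 0 < 2 * alpha. Proof. by move: alpha_half; lra. Qed.
Let half0 : 0 < 2^-1 :> R. Proof. by rewrite invr_gt0. Qed.

Lemma slow_start_sqsummable :
  (fun i => (slow_coord i, slow_coord i)) \in @sqsummable R.
Proof.
apply/asboolP; rewrite (_ : (fun _ => _) =
    geometric (2 * (K * rho) ^+ 2) (rho ^+ 2)); last first.
  apply/funext => i; rewrite /dot2 /geometric /slow_coord/= -exprM mulnC exprM exprS.
  by ring.
apply: is_cvg_geometric_series.
rewrite ger0_norm ?sqr_ge0// expr_lt1 ?powR_ge0//.
suff : rho < 1 `^ (2 * alpha - 1) by rewrite powR1.
apply: (gt0_ltr_powR alpha2); rewrite ?nnegrE//.
by rewrite invf_lt1// ltr1n.
Qed.

(** Both coordinates are used: the second drives the iteration, and the first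
    keeps the initial [x_h] away from zero. *)
Definition slow_start : l2 R := L2 slow_start_sqsummable.

Lemma slow_start_weight i :
  sin (angle i) * slow_coord i = 2 * (1 + a) * (4 * sin (angle i)) `^ (2 * alpha).
Proof.
rewrite /slow_coord sin_angle mulrCA -exprMn mulr_powRB1//.
rewrite powRM ?exprn_ge0//.
rewrite [RHS]mulrA; congr (_ * _).
exact/powR_exprC/ltW/half0.
Qed.

Lemma slow_start_weight_ge k : exists i,
  [/\ 4 * k%:R * sin (angle i) ^+ 2 <= 1, 3 / 4 <= cos (angle i) ^+ 2
    & 2 / k.+1%:R `^ (2 * alpha) <=
      (sin (angle i) * slow_coord i) ^+ 2 / (2 * (1 + a) ^+ 2)].
Proof.
have [i [ks s4 sk]] := @scale_of_time R k; exists i; split=> //.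
  by rewrite cos2sin2; lra.
have s_ge0 : 0 <= sin (angle i) by rewrite sin_angle exprn_ge0 ?ltW.
have s0 : 0 <= 4 * sin (angle i) by rewrite mulr_ge0.
have k0 : 0 < k.+1%:R :> R by [].
rewrite slow_start_weight.
set w := (4 * _) `^ _.
rewrite (_ : _ / (2 * (1 + a) ^+ 2) = 2 * w ^+ 2); last first.
  by field; rewrite gt_eqF ?ltr_pwDl.
rewrite ler_wpM2l// -[leLHS]mul1r ler_pdivrMr ?powR_gt0//.
rewrite expr2 -powRM// -expr2 -powRM ?sqr_ge0//.
rewrite -[leLHS]/((fun=> 1) (2 * alpha)) -powR1.
by apply: (ge0_ler_powR (ltW alpha2_gt0)); rewrite ?nnegrE ?mulr_ge0 ?sqr_ge0.
Qed.

Lemma slow_xf k :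
  1 / k.+1%:R `^ (2 * alpha) <= `|exxf angle a slow_start k| ^+ 2.
Proof.
have [i [ks _ w]] := slow_start_weight_ge k.
have [h _] := exxf_sqnorm_ge a0 slow_start ks.
apply: le_trans h; apply: le_trans w.
by rewrite ler_wpM2r ?invr_ge0 ?powR_ge0// ler1n.
Qed.

Lemma slow_xh k :
  1 / k.+1%:R `^ (2 * alpha) <= `|exxh angle a slow_start k| ^+ 2.
Proof.
have [i [ks c34 w]] := slow_start_weight_ge k.
have p0 : 0 <= (k.+1%:R `^ (2 * alpha))^-1 :> R by rewrite invr_ge0 powR_ge0.
case: k ks w p0 => [|k] ks w p0.
  (* No step has been made: [x_h] is the first coordinate of the start. *)
  apply: le_trans (l2_coord_sqnorm _ i).
  rewrite exxh_coord powR1 divr1 in w *; rewrite /dot2/= mulr0 addr0 -expr2.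
  have a1 : 1 <= (1 + a) ^+ 2 by rewrite exprn_ege1// lerDl.
  have s1 : sin (angle i) ^+ 2 <= 1.
    by rewrite -(cos2Dsin2 (angle i)) lerDr sqr_ge0.
  move: w; rewrite ler_pdivlMr; last by rewrite mulr_gt0// (lt_le_trans _ a1).
  rewrite exprMn => w.
  have := ler_wpM2r (sqr_ge0 (slow_coord i)) s1; lra.
have ks' : 4 * k%:R * sin (angle i) ^+ 2 <= 1 :> R.
  by apply: le_trans ks; rewrite ler_wpM2r ?sqr_ge0// ler_wpM2l// ler_nat.
have [_ h] := exxf_sqnorm_ge a0 slow_start ks'.
apply: le_trans h; apply: le_trans (ler_pM _ _ c34 w); lra.
Qed.

End SlowStart.

(** * Best iterates and the theorem *)

Section BestIterate.
Context {R : realType}.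

Lemma best_iterate_ge (C p : R) (u : nat -> R) k : 0 <= C -> 0 <= p ->
  (forall j, C / j.+1%:R `^ p <= u j) -> C / k.+1%:R `^ p <= best_iterate u k.
Proof.
move=> C0 p0 uC.
have mono j : (j <= k)%N -> C / k.+1%:R `^ p <= u j.
  move=> jk; apply: le_trans (uC j); rewrite ler_wpM2l//.
  by rewrite lef_pV2 ?posrE ?powR_gt0// ge0_ler_powR ?nnegrE// ler_nat ltnS.
rewrite /best_iterate; elim/big_ind: _ => [|x y Cx Cy|j _]; first exact: mono.
  by rewrite le_min Cx.
by apply: mono; rewrite -ltnS.
Qed.

Lemma Sf_nonsmooth (H : hilbertType R) mu (f : H -> \bar R) x y :
  Sf mu 0 f x y = mu / 2 * `|x - y| ^+ 2.
Proof. by rewrite /Sf ltxx. Qed.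

Lemma Sh_ge a theta (z0 : l2 R) k :
  2^-1 * `|exxh theta a z0 k| ^+ 2 <= Sh 1 1 exg exV (exxh theta a z0 k) 0.
Proof.
rewrite /Sh le_max orthproj_exV0 orthproj_exxh subr0 div1r.
by apply/orP; left.
Qed.

End BestIterate.

Unset Implicit Arguments.
Set Strict Implicit.
Set Printing Implicit Defensive.

Theorem theorem6p6 (R : realType) (a : R) (ha : 0 <= a) :
  exists (c theta : nat -> R),
  [/\ (forall i, 0 < theta i <= pi / 2), theta @ \oo --> (0 : R)
    & forall i, c i = cos (theta i)] /\
  (forall z : l2 R, exT theta a z = z <-> z = 0) /\
  let zstar : l2 R := 0 in
  let xstar := orthproj exV zstar in
  (forall z0 : l2 R,
     exxh theta a z0 @ \oo --> xstar /\ exxf theta a z0 @ \oo --> xstar) /\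
  (exists z0 : l2 R,
     ~ converges_linearly (exxh theta a z0) xstar /\
     ~ converges_linearly (exxf theta a z0) xstar) /\
  (exists eps : R,
     best_rate_hyps (exf theta a) exg exV 1 1 0 a 1 eps (fun=> 1)) /\
  forall alpha : R, 1 / 2 < alpha ->
  exists z0 : l2 R,
    (forall k : nat, (1 <= k)%N ->
       `|exxh theta a z0 k - xstar| ^+ 2 >= 1 / k.+1%:R `^ (2 * alpha) /\
       `|exxf theta a z0 k - xstar| ^+ 2 >=
         (a + 1 / 2) ^+ 2 / ((a + 1) ^+ 2 * k.+1%:R `^ (2 * alpha))) /\
    exists2 C : R, 0 < C & forall k : nat,
      let sf j := Sf a 0 (exf theta a) (exxf theta a z0 j) xstar in
      let sh j := Sh 1 1 exg exV (exxh theta a z0 j) xstar in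
      let bound := C / k.+1%:R `^ (2 * alpha) in
      [/\ best_iterate (fun j => sf j + sh j) k >= bound,
          best_iterate sh k >= bound
        & 0 < a -> best_iterate sf k >= bound].
Proof.
exists (fun i => cos (angle i)), angle.
have sin_neq0 i : sin (angle i) != 0 :> R by rewrite sin_angle expf_neq0.
split; first by split=> //; [exact: angle_itv|exact: angle_cvg].
split; first by move=> z; exact: exT_fixed.
move=> zstar xstar.
have -> : xstar = 0 by exact: orthproj_exV0.
split; first exact: exx_cvg.
split.
  (* The exponent [alpha = 1] serves: [k.+1 ^ - 2] decays subgeometrically. *)
  have h1 : 1 / 2 < 1 :> R by rewrite ltr_pdivrMr// mul1r ltr1n.
  exists (slow_start a h1); split; apply: not_linear => k; rewrite subr0.
  - apply: le_trans (slow_xh ha h1 k).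
    by rewrite mulr1 powR_mulrn// div1r.
  - apply: le_trans (slow_xf ha h1 k).
    by rewrite mulr1 powR_mulrn// div1r.
split; first by exists 10^-1; exact: best_rate_hyps_example.
move=> alpha halpha.
have alpha0 : 0 <= 2 * alpha by lra.
exists (slow_start a halpha); split.
  move=> k _; rewrite !subr0; split; first exact: slow_xh.
  apply: le_trans (slow_xf ha halpha k).
  have w0 : 0 <= (k.+1%:R `^ (2 * alpha))^-1 :> R by rewrite invr_ge0 powR_ge0.
  rewrite invfM mulrA ler_wpM2r// ler_pdivrMr ?exprn_gt0 ?ltr_wpDl//.
  by rewrite [leRHS]mul1r ler_sqr ?nnegrE; lra.
(* The factors come from the definitions of [Sh] and, for [0 < a], of [Sf]. *)
set C : R := if 0 < a then Num.min 2^-1 (a / 2) else 2^-1.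
have C0 : 0 < C.
  by rewrite /C; case: ifP => // a0; rewrite lt_min invr_gt0 ltr0n divr_gt0.
have C2 : C <= 2^-1 by rewrite /C; case: ifP => // a0; rewrite ge_min lexx.
exists C => // k sf sh bound.
have scale j D X : C <= D -> 1 / j.+1%:R `^ (2 * alpha) <= X ->
    C / j.+1%:R `^ (2 * alpha) <= D * X.
  rewrite div1r => CD BX; apply: ler_pM CD BX; first exact: ltW.
  by rewrite invr_ge0 powR_ge0.
have sh_ge j : C / j.+1%:R `^ (2 * alpha) <= sh j.
  apply: le_trans (Sh_ge _ _ _ _).
  exact: scale C2 (slow_xh ha halpha j).
have sf_ge0 j : 0 <= sf j by rewrite /sf Sf_nonsmooth mulr_ge0 ?divr_ge0 ?sqr_ge0.
split.
- apply: best_iterate_ge => [||j]; [exact: ltW|exact: alpha0|].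
  by apply: le_trans (sh_ge j) _; rewrite lerDr.
- by apply: best_iterate_ge => [||j]; [exact: ltW|exact: alpha0|exact: sh_ge].
- move=> a0; apply: best_iterate_ge => [||j]; [exact: ltW|exact: alpha0|].
  rewrite /sf Sf_nonsmooth subr0.
  apply: scale (slow_xf ha halpha j).
  by rewrite /C a0 ge_min lexx orbT.
Qed.
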